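(* Let $J\subset\mathbb{R}^n$ be a Jordan curve parametrised by $\gamma:[0,1]\to\mathbb{R}^n$ and let $o=\gamma(0)$. If $J$ is strongly locally monotone at $o$, then there is an equilateral triangle inscribed in $J$ having $o$ as one of its vertices, i.e. there exist $p,q\in J\setminus\{o\}$ such that $o,p,q$ are the vertices of a (nondegenerate) equilateral triangle.
   Context: A Jordan curve in $\mathbb{R}^n$ ($n\ge 2$) is the image $J=\gamma([0,1])$ of a continuous map $\gamma:[0,1]\to\mathbb{R}^n$ with $\gamma(0)=\gamma(1)$ that is injective except at the endpoints. The parametrisation is chosen so that $o=\gamma(0)$. For $p\in J\setminus\{o\}$ define $a_p:[0,1]\to\mathbb{R}$ by $a_p(t)=\overrightarrow{o\gamma(t)}\cdot\dfrac{\overrightarrow{op}}{\|\overrightarrow{op}\|}$. For $\epsilon\in(0,\tfrac12)$, the interval $(1-\epsilon,\epsilon)$ is taken modulo $1$, i.e. it is $(1-\epsilon,1]\cup[0,\epsilon)$ with $1$ and $0$ identified, ordered so as to run from $1-\epsilon$ through $1\equiv0$ to $\epsilon$. $J$ is called strongly (locally) monotone at $o$ if there is some $\epsilon>0$ such that for every $p\in\gamma((1-\epsilon,\epsilon))\setminus\{o\}$ the restriction $a_p|_{(1-\epsilon,\epsilon)}$ is monotone. *)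

(* Defs.v *)
From HB Require Import structures.
From mathcomp Require Import all_boot all_order all_algebra.
From mathcomp Require Import all_classical all_reals all_analysis.

Set Implicit Arguments.
Unset Strict Implicit.
Unset Printing Implicit Defensive.

Import Order.TTheory GRing.Theory Num.Theory.
Import numFieldNormedType.Exports.

Local Open Scope classical_set_scope.
Local Open Scope ring_scope.

(** The library norm [`|u|] on ['rV[R]_n] is the sup norm, so the Euclidean
    structure is set up here. The library topology on ['rV[R]_n], used for
    continuity below, is the usual one of R^n. *)

Definition dotp (R : realType) (n : nat) (u v : 'rV[R]_n) : R :=
  \sum_(i < n) u ord0 i * v ord0 i.

Definition enorm (R : realType) (n : nat) (u : 'rV[R]_n) : R :=
  Num.sqrt (dotp u u).

Definition jordan_parametrisation (R : realType) (n : nat)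
    (gamma : R -> 'rV[R]_n) (J : set 'rV[R]_n) : Prop :=
  [/\ {within `[0, 1], continuous gamma},
      gamma 0 = gamma 1,
      forall s t : R, s \in `[0, 1] -> t \in `[0, 1] -> gamma s = gamma t ->
        [\/ s = t, s = 0 /\ t = 1 | s = 1 /\ t = 0]
    & J = gamma @` `[0, 1]].

(** The cyclic interval [(1 - eps, eps)] of [[0, 1]] modulo 1. *)
Definition cyclic_itv (R : realType) (eps : R) : set R :=
  `]1 - eps, 1] `|` `[0, eps[.

(** For [eps < 1/2], [cyclic_pos] maps [cyclic_itv eps] onto [(- eps, eps)] by
    [t |-> t - 1] on [(1 - eps, 1]] and the identity on [[0, eps)]; it
    identifies 1 with 0, and pulls back the order of the cyclic interval, which
    runs from [1 - eps] through [1 = 0] to [eps]. *)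
Definition cyclic_pos (R : realType) (t : R) : R :=
  if t <= 2^-1 then t else t - 1.

(** Monotone is understood in the weak sense. *)
Definition cyclic_monotone (R : realType) (eps : R) (f : R -> R) : Prop :=
  (forall s t, cyclic_itv eps s -> cyclic_itv eps t ->
     cyclic_pos s <= cyclic_pos t -> f s <= f t)
  \/
  (forall s t, cyclic_itv eps s -> cyclic_itv eps t ->
     cyclic_pos s <= cyclic_pos t -> f t <= f s).

Definition proj_along (R : realType) (n : nat) (gamma : R -> 'rV[R]_n)
    (p : 'rV[R]_n) (t : R) : R :=
  let o := gamma 0 in
  dotp (gamma t - o) ((enorm (p - o))^-1 *: (p - o)).

Definition strongly_locally_monotone (R : realType) (n : nat)
    (gamma : R -> 'rV[R]_n) : Prop :=
  exists2 eps : R, 0 < eps < 2^-1 &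
    forall p : 'rV[R]_n, (gamma @` cyclic_itv eps) p -> p != gamma 0 ->
      cyclic_monotone eps (proj_along gamma p).

Definition equilateral_triangle (R : realType) (n : nat)
    (a b c : 'rV[R]_n) : Prop :=
  [/\ 0 < enorm (b - a),
      enorm (b - a) = enorm (c - b)
    & enorm (c - b) = enorm (a - c)].

(* Main.v *)
(** Write [c t] for [gamma t - o]. Monotonicity of the projections makes [|c|]
    monotone along each of the two branches leaving [o], and puts any vector of
    one branch at an angle of at least 90 degrees with any vector of the other.
    Hence, for a small radius [r], there are [s0 < t0], one on each branch, with
    [|c s0| = |c t0| = r] and [|c| >= r] on [[s0, t0]]. Let [m] maximise [|c|]
    there, and let [x] run from [s0] to [m] and [y] from [t0] to [m]. The angle
    between [c x] and [c y] is obtuse or right at the start and zero at the end.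
    A two-dimensional intermediate value theorem on the square of the pairs
    [(x, y)], a form of the Poincare-Miranda theorem, gives a pair with
    [|c x| = |c y|] whose angle is 60 degrees. *)

Require Import Defs.
From mathcomp Require Import all_boot all_order all_algebra.
From mathcomp Require Import all_classical all_reals all_analysis.
From mathcomp Require Import ring lra.

Import Order.TTheory GRing.Theory Num.Theory.
Import numFieldNormedType.Exports.

Local Open Scope classical_set_scope.
Local Open Scope ring_scope.

(** * Intermediate value theorems on the square, discrete and continuous *)

(** Discrete Stokes modulo 2: the four edges of each cell cancel, so a path between opposite corners
    can be pushed across the grid cell by cell; [strip] crosses one row. *)
Lemma grid_sum (h v : nat -> nat -> bool) (m n : nat) :
  (forall i j, (i < m)%N -> (j < n)%N ->
     h i j (+) v i.+1 j = v i j (+) h i j.+1) ->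
  (\big[addb/false]_(0 <= i < m) h i 0%N) (+) \big[addb/false]_(0 <= j < n) v m j
  = (\big[addb/false]_(0 <= j < n) v 0%N j) (+) \big[addb/false]_(0 <= i < m) h i n.
Proof.
elim: n => [|n IHn] hv; first by rewrite !(big_geq (leqnn 0)) addbF.
have strip k : (k <= m)%N ->
    (\big[addb/false]_(0 <= i < k) h i n) (+) v k n
    = v 0%N n (+) \big[addb/false]_(0 <= i < k) h i n.+1.
  elim: k => [|k IHk] km; first by rewrite !(big_geq (leqnn 0)) addbF.
  by rewrite !big_nat_recr //= -addbA hv // addbA IHk 1?ltnW // addbA.
rewrite !big_nat_recr //= addbA IHn; last by move=> i j im jn; apply: hv => //; exact: ltnW.
by rewrite -addbA strip // addbA.
Qed.

Definition cell_constant (f : nat -> nat -> bool) (i j : nat) : bool :=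
  [&& f i j == f i.+1 j, f i j == f i j.+1 & f i j == f i.+1 j.+1].

(* The 0/1 cochain [h, v] on the edges of the grid, recording a change of [tau]
   across an edge inside [sg], is closed when no cell sees both [sg] and [tau]
   change, so it has the same sum along both paths from (0, 0) to (n, n). *)
Lemma grid_parity (n : nat) (sg tau : nat -> nat -> bool) :
  (forall j, (0 < j <= n)%N -> ~~ sg 0%N j) ->
  (forall i, (i < n)%N -> ~~ sg i n) ->
  (forall i, (i <= n)%N -> sg i 0%N) ->
  (forall j, (j <= n)%N -> sg n j) ->
  (forall i j, (i < n)%N -> (j < n)%N ->
     cell_constant sg i j || cell_constant tau i j) ->
  tau 0%N 0%N = tau n n.
Proof.
move=> left top bottom right cells.
pose h i j := [&& sg i j, sg i.+1 j & tau i j (+) tau i.+1 j].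
pose v i j := [&& sg i j, sg i j.+1 & tau i j (+) tau i j.+1].
have := @grid_sum h v n n.
have -> : \big[addb/false]_(0 <= j < n) v 0%N j = false.
  rewrite big_nat_cond big1 // => j /andP[/andP[_ jn] _].
  by rewrite /v (negbTE (left j.+1 _)) // andbF.
have -> : \big[addb/false]_(0 <= i < n) h i n = false.
  rewrite big_nat_cond big1 // => i /andP[/andP[_ ilt] _].
  by rewrite /h (negbTE (top i _)).
(* Where [sg] is true throughout, the sum of changes of [tau] telescopes. *)
have -> : \big[addb/false]_(0 <= i < n) h i 0%N = tau 0%N 0%N (+) tau n 0%N.
  suff H k : (k <= n)%N ->
      \big[addb/false]_(0 <= i < k) h i 0%N = tau 0%N 0%N (+) tau k 0%N by exact: H.
  elim: k => [|k IHk] kn; first by rewrite big_geq // addbb.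
  rewrite big_nat_recr //= IHk 1?ltnW // /h bottom 1?ltnW // bottom //=.
  by do 3!case: (tau _ _).
have -> : \big[addb/false]_(0 <= j < n) v n j = tau n 0%N (+) tau n n.
  suff H k : (k <= n)%N ->
      \big[addb/false]_(0 <= j < k) v n j = tau n 0%N (+) tau n k by exact: H.
  elim: k => [|k IHk] kn; first by rewrite big_geq // addbb.
  rewrite big_nat_recr //= IHk 1?ltnW // /v right 1?ltnW // right //=.
  by do 3!case: (tau _ _).
move=> E; suff: tau 0%N 0%N (+) tau n n = false by move/negbT; rewrite negb_add => /eqP.
transitivity ((tau 0%N 0%N (+) tau n 0%N) (+) (tau n 0%N (+) tau n n)).
  by do 3!case: (tau _ _).
(* Closedness on a cell: if [tau] is constant, or [sg] is constantly false, all edges are 0; if [sg]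
   is constantly true, the changes of [tau] around the cell cancel. *)
rewrite E // => i j im jn; rewrite /h /v.
by case/orP: (cells i j im jn) => /and3P[/eqP <- /eqP <- /eqP <-];
  rewrite ?addbb ?andbF //; case: (sg i j) => //=; do 4!case: (tau _ _).
Qed.

(* The sign of [F] separates left and top from bottom and right, so that the
   zero set of [F] has to join the corners (0, 0) and (1, 1). *)
Lemma corner_poincare_miranda (R : realType) (F H : R * R -> R) :
  continuous F -> continuous H ->
  (forall t : R, 0 <= t <= 1 -> F (0, t) <= 0) ->
  (forall s : R, 0 <= s <= 1 -> F (s, 1) <= 0) ->
  (forall s : R, 0 <= s <= 1 -> 0 <= F (s, 0)) ->
  (forall t : R, 0 <= t <= 1 -> 0 <= F (1, t)) ->
  H (0, 0) < 0 -> 0 < H (1, 1) ->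
  exists s t : R, [/\ 0 <= s <= 1, 0 <= t <= 1, F (s, t) = 0 & H (s, t) = 0].
Proof.
move=> Fc Hc left top bottom right H0 H1; apply: contrapT => nozero.
pose sq : set (R * R) := `[0, 1] `*` `[0, 1].
(* [Q n z]: one of [F], [H] keeps a strict sign on the ball of radius [1 / (n + 1)] around [z]. *)
pose Q (n : nat) (z : R * R) :=
  [\/ forall w : R * R, ball z n.+1%:R^-1 w -> 0 < F w,
      forall w : R * R, ball z n.+1%:R^-1 w -> F w < 0,
      forall w : R * R, ball z n.+1%:R^-1 w -> 0 < H w |
      forall w : R * R, ball z n.+1%:R^-1 w -> H w < 0].
(* Centre and radius vary together, as near-covering compactness requires: half of [e] pays for
   moving the centre, half for the radius. *)
have small (A : set (R * R)) (z : R * R) : nbhs z A ->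
    \forall z' \near z & n \near \oo, forall w : R * R, ball z' n.+1%:R^-1 w -> A w.
  move=> /nbhs_ballP[e /= e0 eA]; have e20 : 0 < e / 2 by rewrite divr_gt0.
  exists (ball z (e / 2), [set n | n.+1%:R^-1 < e / 2]).
    by split; [exact: nbhsx_ballx | exact: (near_infty_natSinv_lt (PosNum e20))].
  move=> [z' n] /= [zz' ne] w z'w; apply: eA.
  by rewrite [e]splitr; apply: ball_triangle zz' _; apply: le_ball z'w; exact: ltW.
(* By compactness, one mesh size works on the whole square. *)
have [n Qn] : exists n, forall z, sq z -> Q n z.
  have csq : compact sq by apply: compact_setX; exact: segment_compact.
  have /compact_near_coveringP csq' := csq.
  have : \forall n \near \oo, sq `<=` Q n.
    apply: csq' => -[s t] [/=]; rewrite !in_itv /= => s01 t01.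
    have opos : open [set x : R | 0 < x] by exact: open_gt.
    have oneg : open [set x : R | x < 0] by exact: open_lt.
    have nb (G : R * R -> R) (O : set R) : continuous G -> open O -> O (G (s, t)) ->
        \forall z' \near (s, t) & n \near \oo, forall w : R * R, ball z' n.+1%:R^-1 w -> O (G w).
      by move=> Gc oO Oz; apply: (small (G @^-1` O)); apply: Gc; exact: open_nbhs_nbhs.
    have [Fn|Fp|F0] := ltgtP (F (s, t)) 0.
    - have := nb _ _ Fc oneg Fn; apply: filterS => -[z' k] /= h; exact: Or42.
    - have := nb _ _ Fc opos Fp; apply: filterS => -[z' k] /= h; exact: Or41.
    have [Hn|Hp|H00] := ltgtP (H (s, t)) 0.
    - have := nb _ _ Hc oneg Hn; apply: filterS => -[z' k] /= h; exact: Or44.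
    - have := nb _ _ Hc opos Hp; apply: filterS => -[z' k] /= h; exact: Or43.
    by exfalso; apply: nozero; exists s, t.
  by move=> [n _ /(_ n (leqnn n))]; exists n.
(* With [n.+2] subdivisions the mesh is strictly below [1 / (n + 1)], so each cell lies in the open
   ball around its lower left corner. *)
pose N := n.+2; pose c (i : nat) : R := i%:R / N%:R.
have N0 : 0 < N%:R :> R by rewrite ltr0n.
have c01 i : (i <= N)%N -> 0 <= c i <= 1.
  by move=> iN; rewrite divr_ge0 //= ler_pdivrMr // mul1r ler_nat.
have c0 : c 0%N = 0 by rewrite /c mul0r.
have cN : c N = 1 by rewrite /c divff // gt_eqF.
(* [F] may vanish on the left and top sides, where [sg] has to be false. *)
pose forced i j := ((i == 0) && (0 < j) || (j == N) && (i < N))%N.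
pose sg i j := ~~ forced i j && (0 <= F (c i, c j)).
pose tau i j := 0 <= H (c i, c j).
(* Forced vertices also satisfy this, by the boundary conditions; hence [0 < F] near a cell makes
   [sg] true at its four corners. *)
have sgF i j : (i <= N)%N -> (j <= N)%N -> ~~ sg i j -> F (c i, c j) <= 0.
  move=> iN jN; rewrite negb_and negbK => /orP[|]; last by rewrite -ltNge => /ltW.
  case/orP=> /andP[/eqP-> _]; first by rewrite c0; apply/left/c01.
  by rewrite cN; apply/top/c01.
suff: tau 0%N 0%N = tau N N.
  by rewrite /tau c0 cN leNgt H0 (ltW H1).
apply: (@grid_parity N sg).
- by move=> j /andP[j0 _]; rewrite /sg /forced j0.
- by move=> i iN; rewrite /sg /forced iN eqxx orbT.
- by move=> i iN; rewrite /sg /forced ltnn andbF /= c0; apply/bottom/c01.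
- by move=> j jN; rewrite /sg /forced ltnn andbF /= cN; apply/right/c01.
move=> i j iN jN.
have near_pt a b : (i <= a <= i.+1)%N -> (j <= b <= j.+1)%N ->
    ball (c i, c j) n.+1%:R^-1 (c a, c b).
  have near1 k l : (k <= l <= k.+1)%N -> ball (c k) n.+1%:R^-1 (c l).
    move=> /andP[kl lk]; rewrite -ball_normE /ball_ /= distrC /c -mulrBl -natrB //.
    rewrite ger0_norm ?divr_ge0 //; apply: (@le_lt_trans _ _ N%:R^-1).
      by rewrite ler_piMl ?invr_ge0 ?ler0n // -[1]/(1%:R) ler_nat leq_subLR addn1.
    by rewrite ltf_pV2 ?posrE ?ltr0n // ltr_nat.
  by move=> ia jb; split; apply: near1.
have corners : [/\ (i <= i <= i.+1)%N, (i <= i.+1 <= i.+1)%N,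
   (j <= j <= j.+1)%N & (j <= j.+1 <= j.+1)%N] by rewrite !leqnn !leqnSn.
case: corners => ci ci' cj cj'.
have constb (f : nat -> nat -> bool) (b : bool) : 
    (forall x y, (i <= x <= i.+1)%N -> (j <= y <= j.+1)%N -> f x y = b) ->
    cell_constant f i j.
  by move=> fb; rewrite /cell_constant !fb // eqxx.
have bd x y : (i <= x <= i.+1)%N -> (j <= y <= j.+1)%N -> (x <= N)%N /\ (y <= N)%N.
  by move=> /andP[_ xi] /andP[_ yj]; split; [exact: leq_trans xi iN | exact: leq_trans yj jN].
have [||||] := Qn (c i, c j); first by split; rewrite /= in_itv /=; apply/c01/ltnW.
- move=> h; apply/orP; left; apply: (constb _ true) => x y xi yj.
  have [xN yN] := bd _ _ xi yj; apply: contraTT (h _ (near_pt _ _ xi yj)) => /sgF.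
  by rewrite leNgt => ->.
- move=> h; apply/orP; left; apply: (constb _ false) => x y xi yj.
  apply/negbTE; rewrite negb_and; apply/orP; right.
  by rewrite -ltNge; exact: h (near_pt _ _ xi yj).
- move=> h; apply/orP; right; apply: (constb _ true) => x y xi yj.
  by rewrite /tau ltW //; exact: h (near_pt _ _ xi yj).
- move=> h; apply/orP; right; apply: (constb _ false) => x y xi yj.
  by apply/negbTE; rewrite -ltNge; exact: h (near_pt _ _ xi yj).
Qed.

(** * Euclidean inner product and continuity *)

Lemma dotpC (R : realType) (n : nat) (u v : 'rV[R]_n) : dotp u v = dotp v u.
Proof. by apply: eq_bigr => i _; rewrite mulrC. Qed.

Lemma dotp0l (R : realType) (n : nat) (v : 'rV[R]_n) : dotp 0 v = 0.
Proof. by apply: big1 => i _; rewrite mxE mul0r. Qed.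

Lemma dotpNN (R : realType) (n : nat) (u v : 'rV[R]_n) :
  dotp (- u) (- v) = dotp u v.
Proof. by apply: eq_bigr => i _; rewrite !mxE mulrNN. Qed.

Lemma dotpZr (R : realType) (n : nat) (a : R) (u v : 'rV[R]_n) :
  dotp u (a *: v) = a * dotp u v.
Proof. by rewrite mulr_sumr; apply: eq_bigr => i _; rewrite mxE mulrCA. Qed.

Lemma dotpBB (R : realType) (n : nat) (u v : 'rV[R]_n) :
  dotp (u - v) (u - v) = dotp u u - 2 * dotp u v + dotp v v.
Proof.
rewrite mulr_sumr -sumrB -big_split /=; apply: eq_bigr => i _.
by rewrite !mxE; ring.
Qed.

Lemma dotp_ge0 (R : realType) (n : nat) (u : 'rV[R]_n) : 0 <= dotp u u.
Proof. by apply: sumr_ge0 => i _; rewrite -expr2 sqr_ge0. Qed.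

Lemma dotp_gt0 (R : realType) (n : nat) (u : 'rV[R]_n) : u != 0 -> 0 < dotp u u.
Proof.
move=> u0; rewrite lt_def dotp_ge0 andbT; apply: contraNneq u0 => uu0.
apply/eqP/rowP => i; rewrite mxE; apply/eqP; rewrite -sqrf_eq0 expr2.
have /psumr_eq0P uu : dotp u u = 0 by [].
by rewrite uu // => j _; rewrite -expr2 sqr_ge0.
Qed.

Lemma dotp_continuous (R : realType) (n : nat) (T : topologicalType)
    (f g : T -> 'rV[R]_n) :
  continuous f -> continuous g -> continuous (fun t => dotp (f t) (g t)).
Proof.
move=> fc gc; apply: continuous_big; first exact: add_continuous.
move=> i _ t; apply: cvgM.
  exact: (continuous_comp (fc t) (@coord_continuous _ _ _ _ _ _)).
exact: (continuous_comp (gc t) (@coord_continuous _ _ _ _ _ _)).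
Qed.

(** Retracting the line onto the interval extends the curve to a map continuous everywhere, the form
    in which continuity is used later. *)
Lemma continuous_clamp (R : realType) (T : topologicalType) (f : R -> T) (a b : R) :
  a <= b -> {within `[a, b], continuous f} ->
  continuous (fun t => f (Num.max a (Num.min t b))).
Proof.
move=> ab /subspace_continuousP fc t.
have clamp_in u : `[a, b]%classic (Num.max a (Num.min u b)).
  by rewrite /= in_itv /= le_max lexx ge_max ab ge_min lexx orbT.
have clampc : {for t, continuous ((cst a : R -> R^o) \max ((@id R : R -> R^o) \min cst b))}.
  apply: continuous_max; first exact: cvg_cst.
  by apply: continuous_min; [exact: cvg_id | exact: cvg_cst].
move=> A /(fc _ (clamp_in t)) /clampc fA.
apply: (@filterS _ (nbhs t) _ _ _ _ fA) => u; apply; exact: clamp_in.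
Qed.

(** * Finding the 60 degree angle *)

Lemma equilateral_from_arms (R : realType) (n : nat) (c : R -> 'rV[R]_n) (s0 t0 : R) :
  continuous c -> s0 <= t0 -> dotp (c s0) (c s0) = dotp (c t0) (c t0) ->
  0 < dotp (c s0) (c s0) -> dotp (c s0) (c t0) <= 0 ->
  (forall t, s0 <= t <= t0 -> dotp (c s0) (c s0) <= dotp (c t) (c t)) ->
  exists s t : R, [/\ s0 <= s <= t0, s0 <= t <= t0,
    dotp (c s) (c s) = dotp (c t) (c t) &
    2 * dotp (c s) (c t) = dotp (c s) (c s)].
Proof.
move=> cc st0 Dst Ds0 obtuse Dmin.
pose D t := dotp (c t) (c t).
have Dc : continuous D by exact: dotp_continuous.
have [m] := EVT_max st0 (continuous_subspaceT Dc).
rewrite in_itv /= => /andP[s0m mt0] Dmax.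
pose x (z : R * R) := c (s0 + z.1 * (m - s0)).
pose y (z : R * R) := c (t0 + z.2 * (m - t0)).
have armc (pr : R * R -> R) (a b : R) : continuous pr ->
    continuous (fun z => c (a + pr z * (b - a))).
  move=> prc z; have h : {for z, continuous (fun z => a + pr z * (b - a))}.
    by apply: cvgD; [exact: cvg_cst | apply: cvgM; [exact: prc | exact: cvg_cst]].
  exact: (continuous_comp h (cc _)).
have xc : continuous x by apply: (armc fst) => z; exact: cvg_fst.
have yc : continuous y by apply: (armc snd) => z; exact: cvg_snd.
have xin s : 0 <= s <= 1 -> s0 <= s0 + s * (m - s0) <= t0 by nra.
have yin t : 0 <= t <= 1 -> s0 <= t0 + t * (m - t0) <= t0 by nra.
have Dlow t : s0 <= t <= t0 -> D s0 <= D t by exact: Dmin.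
have Dup t : s0 <= t <= t0 -> D t <= D m by move=> ?; apply: Dmax; rewrite in_itv.
have a0 (a b : R) : a + 0 * (b - a) = a by ring.
have a1 (a b : R) : a + 1 * (b - a) = b by ring.
(* On the left and bottom sides one arm sits at the minimal norm; on the top and right sides one arm
   sits at [m], of maximal norm. This gives the signs of the first function. Where it vanishes, the
   second one vanishes exactly when the cosine of the angle is 1/2. *)
have [||||||||s [t [s01 t01]]] := @corner_poincare_miranda R
  (fun z => dotp (x z) (x z) - dotp (y z) (y z))
  (fun z => 2 * dotp (x z) (y z) - dotp (x z) (x z)).
- by move=> z; apply: cvgB; exact: dotp_continuous.
- by move=> z; apply: cvgB; [apply: cvgM; [exact: cvg_cst|]|]; exact: dotp_continuous.
- by move=> t t01; rewrite /x /y /= a0 subr_le0; exact/Dlow/yin.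
- by move=> s s01; rewrite /x /y /= a1 subr_le0; exact/Dup/xin.
- by move=> s s01; rewrite /x /y /= a0 subr_ge0 -Dst; exact/Dlow/xin.
- by move=> t t01; rewrite /x /y /= a1 subr_ge0; exact/Dup/yin.
- by rewrite /x /y /= !a0; lra.
- rewrite /x /y /= !a1; have := Dlow m; rewrite s0m mt0 => /(_ isT).
  by rewrite /D; lra.
rewrite /x /y /= => /subr0_eq DE /subr0_eq HE.
by exists (s0 + s * (m - s0)), (t0 + t * (m - t0)); split => //; [exact: xin | exact: yin].
Qed.

(** * Using strong monotonicity *)

(** The projection along [gamma s] is 0 at the origin of the curve and positive at [s], so the side
    on which [s] lies decides the direction of monotonicity. *)
Lemma monotone_at_dotp (R : realType) (n : nat) (gamma : R -> 'rV[R]_n) (eps s : R) :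
  0 < eps -> gamma s != gamma 0 -> cyclic_itv eps s ->
  cyclic_monotone eps (proj_along gamma (gamma s)) ->
  (0 <= cyclic_pos s -> forall t u, cyclic_itv eps t -> cyclic_itv eps u ->
    cyclic_pos t <= cyclic_pos u ->
    dotp (gamma t - gamma 0) (gamma s - gamma 0)
      <= dotp (gamma u - gamma 0) (gamma s - gamma 0)) /\
  (cyclic_pos s <= 0 -> forall t u, cyclic_itv eps t -> cyclic_itv eps u ->
    cyclic_pos t <= cyclic_pos u ->
    dotp (gamma u - gamma 0) (gamma s - gamma 0)
      <= dotp (gamma t - gamma 0) (gamma s - gamma 0)).
Proof.
move=> eps0 s0 sI mono.
have cs : 0 < dotp (gamma s - gamma 0) (gamma s - gamma 0).
  by apply: dotp_gt0; rewrite subr_eq0.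
have E0 : 0 < (enorm (gamma s - gamma 0))^-1 by rewrite invr_gt0 sqrtr_gt0.
have projE t : proj_along gamma (gamma s) t =
    (enorm (gamma s - gamma 0))^-1 * dotp (gamma t - gamma 0) (gamma s - gamma 0).
  exact: dotpZr.
have I0 : cyclic_itv eps 0 by right; rewrite /= in_itv /= lexx.
have pos0 : cyclic_pos 0 = 0 :> R by rewrite /cyclic_pos invr_ge0 ler0n.
have proj0 : proj_along gamma (gamma s) 0 = 0 by rewrite projE subrr dotp0l mulr0.
have projs : 0 < proj_along gamma (gamma s) s by rewrite projE mulr_gt0.
split=> ps t u tI uI tu; case: mono => mono.
- by have := mono _ _ tI uI tu; rewrite !projE ler_pM2l.
- by have := mono _ _ I0 sI; rewrite pos0 proj0 => /(_ ps); rewrite leNgt projs.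
- by have := mono _ _ sI I0; rewrite pos0 proj0 => /(_ ps); rewrite leNgt projs.
- by have := mono _ _ tI uI tu; rewrite !projE ler_pM2l.
Qed.

(** Expand the squared norm of [v - u], which is nonnegative. This turns growing projections into
    growing norms. *)
Lemma dotp_le_of_proj (R : realType) (n : nat) (u v : 'rV[R]_n) :
  dotp u u <= dotp v u -> dotp u u <= dotp v v.
Proof. by have := dotp_ge0 _ _ (v - u); rewrite dotpBB; lra. Qed.

Theorem theorem5p2 (R : realType) (n : nat) (hn : (2 <= n)%N)
    (J : set 'rV[R]_n) (gamma : R -> 'rV[R]_n) (o : 'rV[R]_n)
    (hJ : jordan_parametrisation gamma J)
    (ho : o = gamma 0)
    (hmono : strongly_locally_monotone gamma) :
  exists p q : 'rV[R]_n,
    [/\ p \in J `\ o, q \in J `\ o & equilateral_triangle o p q].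
Proof.
case: hJ => gc gamma01 ginj ->; case: hmono => eps /andP[eps0 eps2] mono.
have eps4 : eps * 2 < 1 by lra.
rewrite {}ho.
pose c t := gamma (Num.max 0 (Num.min t 1)) - gamma 0.
have clampE t : 0 <= t <= 1 -> Num.max 0 (Num.min t 1) = t.
  by case/andP => t0 t1; rewrite (min_idPl t1) (max_idPr t0).
have cE t : 0 <= t <= 1 -> c t = gamma t - gamma 0 by rewrite /c => /clampE ->.
have cc : continuous c.
  by move=> t; apply: cvgB; [exact: continuous_clamp | exact: cvg_cst].
pose D t := dotp (c t) (c t).
have Dc : continuous D by exact: dotp_continuous.
have gneq0 t : 0 < t < 1 -> gamma t != gamma 0.
  case/andP=> t0 t1; apply/eqP => /ginj; rewrite !in_itv /= lexx ler01 !ltW //.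
  by case=> // [||[]]; lra.
have Dgt0 t : 0 < t < 1 -> 0 < D t.
  move=> t01; apply: dotp_gt0; rewrite cE ?subr_eq0 ?gneq0 //.
  by case/andP: t01 => t0 t1; rewrite !ltW.
(* Since [eps < 1/2], the two branches fall on opposite sides of the threshold in [cyclic_pos]. *)
have Ipos t : 0 <= t < eps -> cyclic_itv eps t /\ cyclic_pos t = t.
  move=> te; split; first by right; rewrite /= in_itv.
  by rewrite /cyclic_pos ifT //; lra.
have Ineg t : 1 - eps < t <= 1 -> cyclic_itv eps t /\ cyclic_pos t = t - 1.
  move=> te; split; first by left; rewrite /= in_itv.
  by rewrite /cyclic_pos ifF //; apply/negbTE; rewrite -ltNge; lra.
have monos s : 0 < s < 1 -> cyclic_itv eps s ->
    cyclic_monotone eps (proj_along gamma (gamma s)).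
  by move=> s01 sI; apply: mono; [exists s | exact: gneq0].
have right_incr s t : 0 < s -> s <= t -> t < eps -> dotp (c s) (c s) <= dotp (c t) (c s).
  move=> s0 st te; have [sI sp] : cyclic_itv eps s /\ cyclic_pos s = s by apply: Ipos; lra.
  have [tI tp] : cyclic_itv eps t /\ cyclic_pos t = t by apply: Ipos; lra.
  have s01 : 0 < s < 1 by lra.
  rewrite !cE; [|lra|lra].
  have [mon _] := monotone_at_dotp _ _ _ _ _ eps0 (gneq0 _ s01) sI (monos _ s01 sI).
  by apply: mon => //; lra.
(* Along [c s] the projection is nondecreasing and vanishes at parameter 0, which [t] precedes in
   the cyclic order. *)
have obtuse s t : 0 < s < eps -> 1 - eps < t < 1 -> dotp (c s) (c t) <= 0.
  move=> se te; have [sI sp] : cyclic_itv eps s /\ cyclic_pos s = s by apply: Ipos; lra.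
  have [tI tp] : cyclic_itv eps t /\ cyclic_pos t = t - 1 by apply: Ineg; lra.
  have [oI op] : cyclic_itv eps 0 /\ cyclic_pos 0 = 0 :> R by apply: Ipos; lra.
  have s01 : 0 < s < 1 by lra.
  rewrite dotpC !cE; [|lra|lra].
  have [mon _] := monotone_at_dotp _ _ _ _ _ eps0 (gneq0 _ s01) sI (monos _ s01 sI).
  by have := mon _ t 0 tI oI; rewrite sp tp op subrr dotp0l; apply; lra.
have left_decr s t : 1 - eps < t -> t <= s -> s < 1 -> dotp (c s) (c s) <= dotp (c t) (c s).
  move=> te ts s1; have [sI sp] : cyclic_itv eps s /\ cyclic_pos s = s - 1 by apply: Ineg; lra.
  have [tI tp] : cyclic_itv eps t /\ cyclic_pos t = t - 1 by apply: Ineg; lra.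
  have s01 : 0 < s < 1 by lra.
  rewrite !cE; [|lra|lra].
  have [_ mon] := monotone_at_dotp _ _ _ _ _ eps0 (gneq0 _ s01) sI (monos _ s01 sI).
  by apply: mon => //; lra.
(* Halving keeps [h] and [1 - h] strictly inside the monotone branches. *)
pose h := eps / 2.
have hE : h * 2 = eps by rewrite /h; lra.
have h1 : h <= 1 - h by lra.
have [m] := EVT_min h1 (continuous_subspaceT Dc).
rewrite in_itv /= => mh Dmin.
have Dm : 0 < D m by apply: Dgt0; lra.
have D0 : D 0 = 0 by rewrite /D cE ?lexx ?ler01 // subrr dotp0l.
have D1 : D 1 = 0 by rewrite /D cE ?lexx ?ler01 // -gamma01 subrr dotp0l.
have Dmin' t : h <= t <= 1 - h -> D m <= D t by move=> ht; apply: Dmin; rewrite in_itv.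
have Dh : D m <= D h by apply: Dmin'; lra.
have Dh' : D m <= D (1 - h) by apply: Dmin'; lra.
(* The squared radius is [D m / 2]: positive, and below [D] on all of [[h, 1 - h]], so each branch
   reaches it between [o] and that middle arc. *)
have ivt a b : a <= b -> Num.min (D a) (D b) <= D m / 2 <= Num.max (D a) (D b) ->
    exists2 s, a <= s <= b & D s = D m / 2.
  move=> ab /(IVT ab (continuous_subspaceT Dc))[s].
  by rewrite in_itv /=; exists s.
have [|| s0 s0h Ds0] := ivt 0 h; first by lra.
  by rewrite D0 ge_min le_max; apply/andP; split; apply/orP; [left | right]; lra.
have [|| t0 t0h Dt0] := ivt (1 - h) 1; first by lra.
  by rewrite D1 ge_min le_max; apply/andP; split; apply/orP; [right | left]; lra.
have s0_gt0 : 0 < s0.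
  rewrite lt_def (andP s0h).1 andbT; apply/eqP => s00; move: Ds0; rewrite s00 D0; lra.
have t0_lt1 : t0 < 1.
  rewrite lt_def (andP t0h).2 andbT; apply/eqP => t01; move: Dt0; rewrite -t01 D1; lra.
have s0eps : 0 < s0 < eps by lra.
have t0eps : 1 - eps < t0 < 1 by lra.
(* Three ranges: the outgoing branch by [right_incr], the middle arc by the choice of [m], the
   returning branch by [left_decr]. *)
have Dlow t : s0 <= t <= t0 -> D s0 <= D t.
  move=> /andP[st tt].
  have [th|ht] := leP t h; first by apply/dotp_le_of_proj/right_incr; lra.
  have [th'|ht'] := leP t (1 - h).
    by rewrite Ds0; have : D m <= D t by [apply: Dmin'; lra]; lra.
  by rewrite Ds0 -Dt0; apply/dotp_le_of_proj/left_decr; lra.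
have [||||| s [t [st tt DE HE]]] := @equilateral_from_arms R n c s0 t0 cc.
- lra.
- by rewrite -/(D s0) -/(D t0) Ds0 Dt0.
- by rewrite -/(D s0) Ds0; lra.
- exact: obtuse.
- exact: Dlow.
have s01 : 0 <= s <= 1 by lra.
have t01 : 0 <= t <= 1 by lra.
have notin u : s0 <= u <= t0 -> gamma u \in (gamma @` `[0, 1]) `\ gamma 0.
  move=> su; rewrite inE; split; last by apply/eqP/gneq0; lra.
  by exists u => //; rewrite /= in_itv /=; lra.
exists (gamma s), (gamma t); split; [exact: notin | exact: notin |].
have Es : gamma s - gamma 0 = c s by rewrite cE.
have Et : gamma 0 - gamma t = - c t by rewrite cE // opprB.
rewrite /equilateral_triangle /enorm Es Et dotpNN -DE.
(* The squared third side is [D s - 2 * dotp (c s) (c t) + D t], which [HE] and [DE] reduce to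
   [D s]. *)
have -> : dotp (gamma t - gamma s) (gamma t - gamma s) = dotp (c s) (c s).
  rewrite -[gamma t - gamma s]opprB dotpNN.
  have -> : gamma s - gamma t = c s - c t by rewrite !cE // opprB addrA subrK.
  by rewrite dotpBB -DE; lra.
by split=> //; rewrite sqrtr_gt0; apply: Dgt0; lra.
Qed.
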